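(* Let $\mathcal R\subseteq P$ be a set of partitions. Then $\mathcal R$ is a skew category of partitions if and only if for all $n\in\mathbb N$ the collection of vector spaces $\mathrm{span}\{\widehat T^{(n)}_p\mid p\in\mathcal R(k,l)\}$, $k,l\in\mathbb N_0$, is a tensor category with duals.
   Context: Partitions. $\mathbb N=\{1,2,\dots\}$, $\mathbb N_0=\mathbb N\cup\{0\}$. For $k,l\in\mathbb N_0$, $P(k,l)$ is the set of all set partitions of $\{1,\dots,k,1',\dots,l'\}$ (with $k$ upper points $1,\dots,k$ and $l$ lower points $1',\dots,l'$), and $P=\bigcup_{k,l}P(k,l)$. For $D\subseteq P$ put $D(k,l)=D\cap P(k,l)$. For $\mathbf i\in\mathbb N^k,\mathbf j\in\mathbb N^l$, $\ker(\mathbf i,\mathbf j)\in P(k,l)$ is the partition in which two points lie in the same block iff they carry the same label, where upper point $x$ carries $i_x$ and lower point $y'$ carries $j_y$. For $p\in P(k,l)$, $\mathrm{ind}(p)=(\mathbf i^{(p)},\mathbf j^{(p)})\in\mathbb N^k\times\mathbb N^l$ is the lexicographically minimal pair with $\ker(\mathrm{ind}(p))=p$. $\mathrm S_\infty$ is the group of bijections $\mathbb N\to\mathbb N$ moving only finitely many points; it acts componentwise on multi-indices, and $\mathrm S_\infty(x)$ denotes the orbit of $x$. Thus $(\mathbf i,\mathbf j)\in \mathrm S_\infty(\mathrm{ind}(p))$ iff $\ker(\mathbf i,\mathbf j)=p$. Juxtaposition of multi-indices is concatenation. Operations. Let $p\in P(k,l)$, $q\in P(k',l')$. The involution $p^*\in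 P(l,k)$ is $p$ turned upside-down. A connected tensor product of $p$ and $q$ is any $\ker(\mathbf{if},\mathbf{jg})\in P(k+k',l+l')$ with $(\mathbf i,\mathbf j)\in \mathrm S_\infty(\mathrm{ind}(p))$, $(\mathbf f,\mathbf g)\in \mathrm S_\infty(\mathrm{ind}(q))$. If $l=k'$, $p$ and $q$ are compatible if $\mathbf j^{(p)}\in \mathrm S_\infty(\mathbf i^{(q)})$. In this case the conditioned composition is the usual composition $qp\in P(k,l')$: place $p$ above $q$, identify the lower points of $p$ with the upper points of $q$, merge blocks accordingly, and restrict to the upper points of $p$ and lower points of $q$. A skew category of partitions is a subset of $P$ containing $\sqcup:=\ker((1,1),\emptyset)$ and $|:=\ker((1),(1))$ and closed under involution, connected tensor products and conditioned composition of compatible partitions. Linear maps. For $n\in\mathbb N$, $\underline n=\{1,\dots,n\}$ and $p\in P(k,l)$, $\widehat T^{(n)}_p:(\mathbb C^n)^{\otimes k}\to(\mathbb C^n)^{\otimes l}$ is the linear map with $\widehat T^{(n)}_p(e_{i_1}\otimes\cdots\otimes e_{i_k})=\sum_{\mathbf j\in\underline n^l}\widehat\delta_p(\mathbf i,\mathbf j)\,e_{j_1}\otimes\cdots\otimes e_{j_l}$, where $\widehat\delta_p(\mathbf i,\mathbf j)=1$ if $(\mathbf i,\mathbf j)\in \mathrm S_\infty(\mathrm{ind}(p))$ and $0$ otherwise. Tensor category with duals (for fixed $n$): a collection of vector spaces $\mathcal H(k,l)\subseteq\mathrm{Hom}((\mathbb C^n)^{\otimes k},(\mathbb C^n)^{\otimes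 l})$, $k,l\in\mathbb N_0$, that is closed under tensor products ($T\in\mathcal H(k,l),T'\in\mathcal H(k',l')\Rightarrow T\otimes T'\in\mathcal H(k+k',l+l')$), composition ($T\in\mathcal H(k,l),T'\in\mathcal H(l,l')\Rightarrow T'T\in\mathcal H(k,l')$) and adjoints ($T\in\mathcal H(k,l)\Rightarrow T^*\in\mathcal H(l,k)$), with $\mathrm{id}_{\mathbb C^n}\in\mathcal H(1,1)$ and with the map $\zeta:\mathbb C\to(\mathbb C^n)^{\otimes2}$, $1\mapsto\sum_{i=1}^n e_i\otimes e_i$, in $\mathcal H(0,2)$. *)

(* Defs.v *)
From HB Require Import structures.
From mathcomp Require Import all_boot all_order all_algebra.
From mathcomp Require Import boolp classical_sets functions cardinality reals.
From mathcomp Require Import complex finset.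

Set Implicit Arguments.
Unset Strict Implicit.
Unset Printing Implicit Defensive.

Import Order.TTheory GRing.Theory Num.Theory.

Local Open Scope ring_scope.

(* The label set {1, 2, ...} is encoded as nat by m |-> m - 1, which preserves
   the order; accordingly {1, ..., n} is 'I_n, embedded into the labels by
   val.  The points of a partition in P(k, l) form the type 'I_k + 'I_l:
   inl x is the upper point x + 1 and inr y the lower point (y + 1)'. *)

Definition part (k l : nat) : Type :=
  {p : {set {set 'I_k + 'I_l}} | partition p [set: 'I_k + 'I_l]%SET}.

Definition same_block k l (p : part k l) (x y : 'I_k + 'I_l) : bool :=
  y \in pblock (val p) x.

Section Kernel.
Variables k l : nat.

Definition label (i : k.-tuple nat) (j : l.-tuple nat) (x : 'I_k + 'I_l) : nat :=
  match x with inl a => tnth i a | inr b => tnth j b end.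

Definition ker (i : k.-tuple nat) (j : l.-tuple nat) : part k l :=
  exist _ (preim_partition (label i j) [set: 'I_k + 'I_l]%SET)
        (preim_partitionP (label i j) _).

Definition lex_le (a b : k.-tuple nat * l.-tuple nat) : Prop :=
  ((a.1 ++ a.2 : seqlexi nat) <= (b.1 ++ b.2 : seqlexi nat))%O.

Definition is_ind (p : part k l) (a : k.-tuple nat * l.-tuple nat) : Prop :=
  ker a.1 a.2 = p /\ (forall b, ker b.1 b.2 = p -> lex_le a b).

(* The default value of xget is irrelevant: see indP. *)
Definition ind (p : part k l) : k.-tuple nat * l.-tuple nat :=
  xget (nseq_tuple k 0%N, nseq_tuple l 0%N) (is_ind p).

Lemma ker_surj (p : part k l) : exists i j, ker i j = p.
Proof.
pose f x := nat_of_ord (enum_rank (pblock (val p) x)).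
exists [tuple f (inl a) | a < k], [tuple f (inr b) | b < l].
apply/val_inj => /=.
have lf x : label [tuple f (inl a) | a < k] [tuple f (inr b) | b < l] x = f x.
  by case: x => a /=; rewrite tnth_mktuple.
have pP := valP p.
rewrite -[RHS](equivalence_partition_pblock pP).
rewrite /preim_partition /equivalence_partition.
apply: eq_imset => x; apply/setP => y; rewrite !inE /= !lf /f.
have [tp cp] : trivIset (val p) /\ cover (val p) = [set: 'I_k + 'I_l]%SET.
  by case/and3P: pP => /eqP.
rewrite -eq_pblock ?cp ?inE //; apply/eqP/eqP => [/ord_inj/enum_rank_inj //|-> //].
Qed.

Lemma lexi_min m (S : set (seq nat)) : (exists2 s, S s & size s = m) ->
  exists s, [/\ S s, size s = m & forall t, S t -> size t = m ->
    ((s : seqlexi nat) <= (t : seqlexi nat))%O].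
Proof.
elim: m S => [|m IH] S [s Ss zs].
  by exists s; split=> // t _ _; move/size0nil: zs => ->.
have ex : exists h, `[< exists2 t, S (h :: t) & size t = m >].
  by case: s Ss zs => // h s Ss [zs]; exists h; apply/asboolP; exists s.
have [h /asboolP [t St zt] hmin] := ex_minnP ex.
have [|u [Su zu umin]] := IH (fun u => S (h :: u)); first by exists t.
exists (h :: u); split=> //; first by rewrite /= zu.
case=> // h' u' Su' [zu']; rewrite Order.SeqLexiOrder.lexi_cons.
have hh' : (h <= h')%N by apply: hmin; apply/asboolP; exists u'.
rewrite leEnat hh' /=; apply/implyP => h'h.
have eh : h = h' by apply/eqP; rewrite eqn_leq hh'.
by apply: umin => //; rewrite eh.
Qed.

Lemma indP (p : part k l) : is_ind p (ind p).
Proof.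
apply: xgetPex.
pose S (s : seq nat) := exists i : k.-tuple nat, exists j : l.-tuple nat,
  ker i j = p /\ s = i ++ j.
have [|s [[i [j [pE ->]]] _ smin]] := @lexi_min (k + l) S.
  have [i [j pE]] := ker_surj p.
  by exists (i ++ j); [exists i, j | rewrite size_cat !size_tuple].
exists (i, j); split=> // -[i' j'] /= pE'; apply: smin; first by exists i', j'.
by rewrite size_cat !size_tuple.
Qed.

End Kernel.

Definition S_infty (s : nat -> nat) : Prop :=
  bijective s /\ finite_set [set m | s m <> m]%classic.

Definition same_orbit k (i i' : k.-tuple nat) : Prop :=
  exists s, S_infty s /\ i = map_tuple s i'.

Definition same_orbit2 k l (a b : k.-tuple nat * l.-tuple nat) : Prop :=
  exists s, S_infty s /\ a = (map_tuple s b.1, map_tuple s b.2).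

Section Operations.

Definition flip k l (x : 'I_k + 'I_l) : 'I_l + 'I_k :=
  match x with inl a => inr a | inr b => inl b end.

Lemma flipK k l : cancel (@flip k l) (@flip l k). Proof. by case. Qed.

Lemma involution_subproof k l (p : part k l) :
  partition [set (@flip k l) @: B | B : {set 'I_k + 'I_l} in val p]%SET
            [set: 'I_l + 'I_k]%SET.
Proof.
have -> : [set: 'I_l + 'I_k]%SET = (@flip k l @: [set: 'I_k + 'I_l])%SET.
  by apply/setP => x; rewrite !inE; apply/esym/imsetP; exists (flip x);
     rewrite ?inE ?flipK.
rewrite imset_partition; [exact: valP p | exact: can_inj (@flipK k l)].
Qed.

Definition involution k l (p : part k l) : part l k :=
  exist _ [set (@flip k l) @: B | B : {set 'I_k + 'I_l} in val p]%SET
        (involution_subproof p).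

(* The points of p placed above q: upper points of p, lower points of p
   identified with upper points of q, lower points of q.  The composition qp
   below is written composition p q. *)
Definition glued k m l : finType := (('I_k + 'I_m) + 'I_l)%type.

Definition glue_up k m l (x : 'I_k + 'I_m) : glued k m l := inl x.

Definition glue_lo k m l (x : 'I_m + 'I_l) : glued k m l :=
  match x with inl b => inl (inr b) | inr c => inr c end.

Definition glue_ext k m l (x : 'I_k + 'I_l) : glued k m l :=
  match x with inl a => inl (inl a) | inr c => inr c end.

Definition glue_rel k m l (p : part k m) (q : part m l) : rel (glued k m l) :=
  fun u v =>
    [exists x, exists y, [&& u == glue_up l x, v == glue_up l y & same_block p x y]]
    || [exists x, exists y,
          [&& u == glue_lo k x, v == glue_lo k y & same_block q x y]].

Definition comp_rel k m l (p : part k m) (q : part m l) : rel ('I_k + 'I_l) :=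
  fun x y => connect (glue_rel p q) (glue_ext m x) (glue_ext m y).

Lemma same_block_sym k l (p : part k l) : symmetric (same_block p).
Proof.
move=> x y; have /and3P[/eqP cp tp _] := valP p.
by rewrite /same_block -!eq_pblock ?cp ?inE // eq_sym.
Qed.

Lemma comp_subproof k m l (p : part k m) (q : part m l) :
  partition (equivalence_partition (comp_rel p q) [set: 'I_k + 'I_l]%SET)
            [set: 'I_k + 'I_l]%SET.
Proof.
have gsym : connect_sym (glue_rel p q).
  apply: sym_connect_sym => u v; rewrite /glue_rel.
  by congr orb; apply/existsP/existsP => -[x /existsP[y /and3P[? ? xy]]];
    exists y; apply/existsP; exists x; apply/and3P; split=> //;
    rewrite same_block_sym.
apply: equivalence_partitionP => x y z _ _ _; split; first exact: connect0.
by rewrite /comp_rel => /(same_connect gsym) ->.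
Qed.

Definition composition k m l (p : part k m) (q : part m l) : part k l :=
  exist _ (equivalence_partition (comp_rel p q) [set: 'I_k + 'I_l]%SET)
        (comp_subproof p q).

Definition compatible k m l (p : part k m) (q : part m l) : Prop :=
  same_orbit (ind p).2 (ind q).1.

Definition connected_tensor k l k' l' (p : part k l) (q : part k' l')
    (r : part (k + k') (l + l')) : Prop :=
  exists i j f g, [/\ same_orbit2 (i, j) (ind p), same_orbit2 (f, g) (ind q)
    & r = ker (cat_tuple i f) (cat_tuple j g)].

Definition cup : part 2 0 := ker [tuple 0%N; 0%N] [tuple].

Definition idpart : part 1 1 := ker [tuple 0%N] [tuple 0%N].

End Operations.

Record skew_category (D : forall k l, {set part k l}) : Prop := SkewCategory {
  skew_cup : cup \in D 2%N 0%N;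
  skew_id : idpart \in D 1%N 1%N;
  skew_involution : forall k l (p : part k l),
    p \in D k l -> involution p \in D l k;
  skew_tensor : forall k l k' l' (p : part k l) (q : part k' l') r,
    p \in D k l -> q \in D k' l' -> connected_tensor p q r ->
    r \in D (k + k')%N (l + l')%N;
  skew_composition : forall k m l (p : part k m) (q : part m l),
    p \in D k m -> q \in D m l -> compatible p q -> composition p q \in D k l
}.

Section LinearMaps.
Variables (R : realType) (n : nat).

Local Notation C := (R[i]).

(* (C^n)^{(x)k}, a vector being given by its coordinates on the basis of the
   e_{i_1} (x) ... (x) e_{i_k}. *)
Definition tens (k : nat) : vectType C := {ffun k.-tuple 'I_n -> C^o}.

Definition basis k (i : k.-tuple 'I_n) : tens k := [ffun j => (j == i)%:R].

Definition lin_of k (W : vectType C) (f : k.-tuple 'I_n -> W) (x : tens k) : W :=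
  \sum_i (x i : C) *: f i.

Lemma lin_of_is_linear k (W : vectType C) (f : k.-tuple 'I_n -> W) :
  linear (lin_of f).
Proof.
move=> a x y; rewrite /lin_of scaler_sumr -big_split; apply: eq_bigr => i _ /=.
by rewrite !ffunE scalerDl scalerA.
Qed.

HB.instance Definition _ k (W : vectType C) (f : k.-tuple 'I_n -> W) :=
  GRing.isLinear.Build C (tens k) W _ (lin_of f) (lin_of_is_linear f).

Definition lin_ext k (W : vectType C) (f : k.-tuple 'I_n -> W) : 'Hom(tens k, W) :=
  linfun (lin_of f).

Lemma lin_extE k (W : vectType C) (f : k.-tuple 'I_n -> W) i :
  lin_ext f (basis i) = f i.
Proof.
rewrite lfunE /= /lin_of (bigD1 i) //= ffunE eqxx scale1r big1 ?addr0 // => j ji.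
by rewrite ffunE (negbTE ji) scale0r.
Qed.

Lemma tens_decomp k (x : tens k) : x = \sum_i (x i : C) *: basis i.
Proof.
apply/ffunP => j; rewrite sum_ffunE (bigD1 j) //= !ffunE eqxx big1 => [|i ij].
  by rewrite addr0 /GRing.scale /= mulr1.
by rewrite !ffunE eq_sym (negbTE ij) scaler0.
Qed.

Definition up_label k (i : k.-tuple 'I_n) : k.-tuple nat := map_tuple val i.

Definition delta_hat k l (p : part k l) (i : k.-tuple 'I_n) (j : l.-tuple 'I_n) : C :=
  if `[< same_orbit2 (up_label i, up_label j) (ind p) >] then 1 else 0.

Definition T_hat k l (p : part k l) : 'Hom(tens k, tens l) :=
  lin_ext (fun i => \sum_j delta_hat p i j *: basis j).

Lemma lfun_coord k l (S : 'Hom(tens k, tens l)) (u : tens k) j :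
  S u j = \sum_i (u i : C) * S (basis i) j.
Proof.
rewrite [in LHS](tens_decomp u) linear_sum sum_ffunE; apply: eq_bigr => i _.
by rewrite linearZ ffunE.
Qed.

Definition left_part k k' (i : (k + k').-tuple 'I_n) : k.-tuple 'I_n :=
  [tuple tnth i (lshift k' a) | a < k].

Definition right_part k k' (i : (k + k').-tuple 'I_n) : k'.-tuple 'I_n :=
  [tuple tnth i (rshift k a) | a < k'].

Lemma left_part_cat k k' (i : k.-tuple 'I_n) (f : k'.-tuple 'I_n) :
  left_part (cat_tuple i f) = i.
Proof. by apply: eq_from_tnth => a; rewrite tnth_mktuple tnth_lshift. Qed.

Lemma right_part_cat k k' (i : k.-tuple 'I_n) (f : k'.-tuple 'I_n) :
  right_part (cat_tuple i f) = f.
Proof. by apply: eq_from_tnth => a; rewrite tnth_mktuple tnth_rshift. Qed.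

Lemma cat_left_right k k' (i : (k + k').-tuple 'I_n) :
  cat_tuple (left_part i) (right_part i) = i.
Proof.
apply: eq_from_tnth => a; rewrite -[a]fintype.splitK.
by case: (fintype.split a) => b /=; rewrite ?tnth_lshift ?tnth_rshift tnth_mktuple.
Qed.

Definition vtensor k k' (u : tens k) (v : tens k') : tens (k + k') :=
  [ffun i => u (left_part i) * v (right_part i)].

Definition htensor k l k' l' (S : 'Hom(tens k, tens l)) (T : 'Hom(tens k', tens l')) :
    'Hom(tens (k + k'), tens (l + l')) :=
  lin_ext (fun i : (k + k').-tuple 'I_n =>
    vtensor (S (basis (left_part i))) (T (basis (right_part i)))).

Lemma htensorE k l k' l' (S : 'Hom(tens k, tens l)) (T : 'Hom(tens k', tens l')) u v :
  htensor S T (vtensor u v) = vtensor (S u) (T v).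
Proof.
apply/ffunP => j; rewrite [RHS]ffunE !lfun_coord.
rewrite mulr_suml; under [RHS]eq_bigr => a _ do rewrite mulr_sumr.
rewrite pair_bigA /=.
rewrite (reindex (fun ab : k.-tuple 'I_n * k'.-tuple 'I_n => cat_tuple ab.1 ab.2)) /=.
  apply: eq_bigr => -[a b] _ /=.
  by rewrite lin_extE !ffunE !left_part_cat !right_part_cat mulrACA.
exists (fun i => (left_part i, right_part i)) => [[a b] _|i _] /=.
  by rewrite left_part_cat right_part_cat.
exact: cat_left_right.
Qed.

Definition inner k (x y : tens k) : C := \sum_i x i * (y i : C)^*%R.

Definition adjoint k l (T : 'Hom(tens k, tens l)) : 'Hom(tens l, tens k) :=
  lin_ext (fun j => \sum_i (T (basis i) j : C)^*%R *: basis i).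

Lemma adjointP k l (T : 'Hom(tens k, tens l)) x y :
  inner (T x) y = inner x (adjoint T y).
Proof.
rewrite /inner; under eq_bigr => j _ do rewrite lfun_coord mulr_suml.
rewrite exchange_big; apply: eq_bigr => i _ /=.
rewrite lfun_coord rmorph_sum mulr_sumr; apply: eq_bigr => j _ /=.
rewrite lin_extE sum_ffunE (bigD1 i) //= big1 => [|i' /negbTE ii'].
  rewrite addr0 !ffunE eqxx /GRing.scale /= mulr1 rmorphM /= conjCK.
  by rewrite -mulrA; congr (_ * _); rewrite mulrC.
by rewrite !ffunE eq_sym ii' scaler0.
Qed.

(* C is identified with tens 0, whose only basis vector is basis [tuple]. *)
Definition zeta : 'Hom(tens 0, tens 2) :=
  lin_ext (fun _ => \sum_(i < n) basis [tuple i; i]).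

Record tensor_category_with_duals
    (H : forall k l, {vspace 'Hom(tens k, tens l)}) : Prop := TensorCategory {
  tc_tensor : forall k l k' l' (S : 'Hom(tens k, tens l)) (T : 'Hom(tens k', tens l')),
    S \in H k l -> T \in H k' l' -> htensor S T \in H (k + k')%N (l + l')%N;
  tc_comp : forall k m l (S : 'Hom(tens k, tens m)) (T : 'Hom(tens m, tens l)),
    S \in H k m -> T \in H m l -> (T \o S)%VF \in H k l;
  tc_adjoint : forall k l (T : 'Hom(tens k, tens l)),
    T \in H k l -> adjoint T \in H l k;
  tc_id : \1%VF \in H 1%N 1%N;
  tc_zeta : zeta \in H 0%N 2%N
}.

Definition span_T (D : forall k l, {set part k l}) (k l : nat) :
    {vspace 'Hom(tens k, tens l)} :=
  (<<[seq T_hat p | p in D k l]>>)%VS.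

End LinearMaps.

(* Main.v *)
Require Import Defs.
From mathcomp Require Import all_boot all_order all_algebra.
From mathcomp Require Import perm.
From mathcomp Require Import boolp cardinality reals.
From mathcomp Require Import complex.

Set Implicit Arguments.
Unset Strict Implicit.
Unset Printing Implicit Defensive.

Import Order.TTheory GRing.Theory Num.Theory.

Local Open Scope ring_scope.

(** A partition is handled through any pair of words (s, t) whose kernel it is;
[word_in D s t] says that the partition of such a pair lies in D, and depends
only on which letters agree.  In these terms the three operations of a skew
category read: turn (s, t) into (t, s); concatenate (s, t) and (u, v) into
(su, tv) with arbitrary coincidences of letters between the two pairs; and
compose (s, t) with (t, u) into (s, u), provided that every letter shared by s
and u occurs in t ([composition_ker]).

On the linear side, the matrix entry of T_p at (i, j) is 1 or 0 according to
whether (i, j) has kernel p.  Hence an operator lies in the span of the T_p,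
p in D, exactly when its entries depend only on the kernel of the indices and
vanish when this kernel is not in D ([mem_span_T]).

Suppose D is a skew category.  Tensor products and adjoints of operators in
the spans are read off entrywise.  The entry of a product at (i, j) is a sum
over intermediate words h, and a nonzero summand puts (i, h) and (h, j) in D.
But i and j may share letters missing from h, so conditioned composition does
not apply; the product of T_p and T_q can involve partitions other than the
composition, in which upper blocks have been joined to lower ones.  The key
point is that D nevertheless contains (i, j): composition of words in D is
unconditional ([word_in_comp]).  Indeed, append i to all the words; the side
condition then holds and gives (ii, ji) in D, and common final letters can be
cancelled with the help of cups ([word_in_cancel]).  That the entries of a
product depend only on the kernel follows by renaming the summation index by a
permutation.

Conversely, given partitions in D, choose words for them, with the middle word
shared and no superfluous coincidences in the case of a composition
([compatible_labels]), and take n larger than all letters.  The matrix entry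
of the tensor product, adjoint or product of the corresponding T's at the
relevant words is a positive integer, because a sum of 0s and 1s with a term
1 cannot vanish in characteristic 0; so the kernel of these words is in D. *)

(** * Equal kernels and relabelling *)

(** Along an enumeration of X, each step corrects the permutation found so far
by a transposition, which does not disturb the points already treated. *)
Lemma perm_of_same_kernel (X T : finType) (f g : X -> T) :
  (forall x y, (f x == f y) = (g x == g y)) ->
  exists s : {perm T}, forall x, f x = s (g x).
Proof.
move=> fg; suff [s sE] : exists s : {perm T}, {in enum X, forall x, f x = s (g x)}.
  by exists s => x; apply: sE; rewrite mem_enum.
elim: (enum X) => [|x xs [s sE]]; first by exists 1%g.
have [/hasP[y yxs gxy]|/hasPn new] := boolP (has (fun y => g x == g y) xs).
  exists s => z; rewrite inE => /predU1P[->|/sE //].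
  by rewrite (eqP gxy) -sE //; apply/eqP; rewrite fg.
exists (s * tperm (s (g x)) (f x))%g => y; rewrite inE permM.
case: (eqVneq y x) => [-> _|_ /= yxs]; first by rewrite tpermL.
have ygx : g x != g y by exact: new.
by rewrite tpermD ?(inj_eq perm_inj) -?(sE y yxs) ?fg.
Qed.

(** All labels lie below some N, so that a permutation of 'I_N extended by the
identity does the job. *)
Lemma S_infty_of_same_kernel (X : finType) (f g : X -> nat) :
  (forall x y, (f x == f y) = (g x == g y)) ->
  exists2 s, S_infty s & forall x, f x = s (g x).
Proof.
move=> fg; pose N := (\max_x maxn (f x) (g x)).+1.
have bnd x : (maxn (f x) (g x) < N)%N by rewrite ltnS (leq_bigmax x).
have fN x : (f x < N)%N by apply: leq_ltn_trans (bnd x); rewrite leq_maxl.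
have gN x : (g x < N)%N by apply: leq_ltn_trans (bnd x); rewrite leq_maxr.
have [s sE] := @perm_of_same_kernel X 'I_N (fun x => Ordinal (fN x))
  (fun x => Ordinal (gN x)) fg.
pose ext (t : {perm 'I_N}) m := oapp (fun a => val (t a)) m (insub m).
have extK (t u : {perm 'I_N}) : (forall a, u (t a) = a) -> cancel (ext t) (ext u).
  move=> tu m; rewrite /ext; case: insubP => [a _ am|mN] /=.
    by rewrite valK /= tu.
  by rewrite insubN.
exists (ext s).
  split; first by exists (ext s^-1)%g; apply: extK => a; rewrite ?permK ?permKV.
  apply: (sub_finite_set _ (finite_II N)) => m /=; rewrite /ext.
  by case: insubP.
by move=> x; rewrite /ext -[g x]/(val (Ordinal (gN x))) valK; apply: (congr1 val (sE x)).
Qed.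

Lemma S_infty_inj s : S_infty s -> injective s.
Proof. by case=> /bij_inj. Qed.

(** * Partitions as kernels of words *)

Section KernelLemmas.
Variables k l : nat.
Implicit Types p q : part k l.

Lemma same_blockP p x y :
  reflect (exists B, [/\ B \in val p, x \in B & y \in B]) (same_block p x y).
Proof.
have /and3P[/eqP cp tp _] := valP p.
apply: (iffP idP) => [xy|[B [Bp xB yB]]]; last by rewrite /same_block (def_pblock tp Bp).
by exists (pblock (val p) x); rewrite pblock_mem ?mem_pblock ?cp ?inE.
Qed.

Lemma part_ext p q : same_block p =2 same_block q -> p = q.
Proof.
move=> pq; apply: val_inj => /=.
rewrite -(equivalence_partition_pblock (valP p)).
rewrite -(equivalence_partition_pblock (valP q)).
apply: eq_imset => x; apply/setP => y; rewrite !inE /=; exact: pq.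
Qed.

Lemma same_block_equivalence (R : rel ('I_k + 'I_l)) p :
  equivalence_rel R -> val p = equivalence_partition R [set: 'I_k + 'I_l] ->
  same_block p =2 R.
Proof.
move=> eR pE x y; rewrite /same_block pE.
by rewrite pblock_equivalence_partition ?inE // => a b c _ _ _; apply: eR.
Qed.

Lemma same_block_ker (i : k.-tuple nat) (j : l.-tuple nat) x y :
  same_block (ker i j) x y = (label i j x == label i j y).
Proof.
rewrite (@same_block_equivalence (fun x y => label i j x == label i j y)) //.
by move=> a b c; split=> // /eqP ->.
Qed.

Lemma ker_eqP (i i' : k.-tuple nat) (j j' : l.-tuple nat) :
  ker i j = ker i' j' <->
  forall x y, (label i j x == label i j y) = (label i' j' x == label i' j' y).
Proof.
split=> [E x y|E]; first by rewrite -!same_block_ker E.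
by apply: part_ext => x y; rewrite !same_block_ker.
Qed.

Lemma label_map (s : nat -> nat) (i : k.-tuple nat) (j : l.-tuple nat) x :
  label (map_tuple s i) (map_tuple s j) x = s (label i j x).
Proof. by case: x => a; rewrite /= tnth_map. Qed.

Lemma ker_map (s : nat -> nat) (i : k.-tuple nat) (j : l.-tuple nat) :
  {in i ++ j &, injective s} -> ker (map_tuple s i) (map_tuple s j) = ker i j.
Proof.
move=> sI; apply/ker_eqP => x y; rewrite !label_map (inj_in_eq sI) //.
  by case: x => a /=; rewrite mem_cat mem_tnth ?orbT.
by case: y => a /=; rewrite mem_cat mem_tnth ?orbT.
Qed.

(** Replaces the canonical labelling [ind p] by an arbitrary one: everything
below is expressed through kernels. *)
Lemma orbit_indP (i : k.-tuple nat) (j : l.-tuple nat) p :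
  same_orbit2 (i, j) (ind p) <-> ker i j = p.
Proof.
have [kp _] := indP p; split=> [[s [sS [-> ->]]]|kij].
  by rewrite ker_map // => x y _ _; apply: S_infty_inj.
rewrite -kp in kij; move/ker_eqP: kij => /S_infty_of_same_kernel[s sS sE].
exists s; split=> //; congr pair; apply: eq_from_tnth => a; rewrite tnth_map.
  exact: (sE (inl a)).
exact: (sE (inr a)).
Qed.

End KernelLemmas.

Lemma same_orbitP k (i i' : k.-tuple nat) :
  same_orbit i i' <->
  forall a b, (tnth i a == tnth i b) = (tnth i' a == tnth i' b).
Proof.
split=> [[s [/S_infty_inj sI ->]] a b|/S_infty_of_same_kernel[s sS sE]].
  by rewrite !tnth_map (inj_eq sI).
by exists s; split=> //; apply: eq_from_tnth => a; rewrite tnth_map sE.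
Qed.

Lemma compatible_ker k m l (i : k.-tuple nat) (h : m.-tuple nat) (j : l.-tuple nat) :
  compatible (ker i h) (ker h j).
Proof.
apply/same_orbitP => a b.
have [/ker_eqP Ep _] := indP (ker i h); have [/ker_eqP Eq _] := indP (ker h j).
by have /= -> := Ep (inr a) (inr b); have /= -> := Eq (inl a) (inl b).
Qed.

Lemma involution_ker k l (i : k.-tuple nat) (j : l.-tuple nat) :
  involution (ker i j) = ker j i.
Proof.
have flip_label x : label j i (@flip k l x) = label i j x by case: x.
apply: part_ext => x y; rewrite same_block_ker.
rewrite -(flipK x) -(flipK y) !flip_label -same_block_ker.
apply/same_blockP/same_blockP => -[B [Bp xB yB]]; last first.
  by exists (@flip k l @: B)%SET; split; apply: imset_f.
case/imsetP: Bp xB yB => B' B'p ->.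
rewrite !mem_imset; [|exact: can_inj (@flipK k l)..].
by exists B'.
Qed.

(** In the glued picture each connected component carries a single label, and
an upper and a lower point with the same label are joined through any middle
point with this label: the hypothesis provides one. *)
Lemma composition_ker k m l (i : k.-tuple nat) (h : m.-tuple nat) (j : l.-tuple nat) :
  (forall a, a \in i -> a \in j -> a \in h) ->
  composition (ker i h) (ker h j) = ker i j.
Proof.
move=> ihj; set p := ker i h; set q := ker h j.
pose lab (u : glued k m l) : nat :=
  match u with inl x => label i h x | inr c => tnth j c end.
have lab_lo y : lab (glue_lo k y) = label h j y by case: y.
have lab_ext x : lab (glue_ext m x) = label i j x by case: x.
have edge_lab u v : glue_rel p q u v -> lab u = lab v.
  case/orP => /existsP[x /existsP[y /and3P[/eqP -> /eqP ->]]];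
    rewrite same_block_ker => /eqP; by rewrite ?lab_lo.
have conn_lab u v : connect (glue_rel p q) u v -> lab u = lab v.
  case/connectP => s; elim: s u => [|w s IH] u /=; first by move=> _ ->.
  by case/andP=> /edge_lab -> /IH H /H.
have up x y : label i h x = label i h y ->
    connect (glue_rel p q) (glue_up l x) (glue_up l y).
  move=> xy; apply/connect1/orP; left; apply/existsP; exists x; apply/existsP; exists y.
  by rewrite !eqxx same_block_ker xy /=.
have lo x y : label h j x = label h j y ->
    connect (glue_rel p q) (glue_lo k x) (glue_lo k y).
  move=> xy; apply/connect1/orP; right; apply/existsP; exists x; apply/existsP; exists y.
  by rewrite !eqxx same_block_ker xy /=.
have compE x y : comp_rel p q x y = (label i j x == label i j y).
  apply/idP/eqP => [/conn_lab|]; first by rewrite !lab_ext.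
  rewrite /comp_rel; case: x y => [a|c] [a'|c'] /= E.
  - exact: (up (inl a) (inl a')).
  - have /tnthP[b hb] : tnth i a \in h by apply: ihj; rewrite 1?mem_tnth // E mem_tnth.
    apply: connect_trans (up (inl a) (inr b) hb) _.
    by apply: (lo (inl b) (inr c')); rewrite /= -hb.
  - have /tnthP[b hb] : tnth j c \in h by apply: ihj; rewrite 1?mem_tnth // E mem_tnth.
    apply: connect_trans (lo (inr c) (inl b) hb) _.
    by apply: (up (inr b) (inl a')); rewrite /= -hb.
  - exact: (lo (inr c) (inr c')).
apply: part_ext => x y; rewrite same_block_ker -compE.
apply: same_block_equivalence => // a b c; rewrite !compE.
by split=> // /eqP ->.
Qed.

Lemma labels_bounded (s : seq nat) : exists N, forall a, a \in s -> (a < N.+1)%N.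
Proof.
by exists (\max_(a <- s) a)%N => a sa; rewrite ltnS (big_rem a sa) leq_maxl.
Qed.

(** Compatibility lets the middle word be shared; the letters of the lower word
of q that do not occur in the middle are then shifted beyond all other letters,
so that no accidental coincidence with the upper word of p remains. *)
Lemma compatible_labels k m l (p : part k m) (q : part m l) :
  compatible p q ->
  exists i h j, [/\ ker i h = p, ker h j = q
    & forall a, a \in i -> a \in j -> a \in h].
Proof.
case=> s [sS hE].
have [kp _] := indP p; have [kq _] := indP q.
set i := (ind p).1 in kp *; set h := (ind p).2 in kp hE *.
have kq' : ker h (map_tuple s (ind q).2) = q.
  by rewrite hE ker_map // => x y _ _; apply: S_infty_inj.
have [M bnd] := labels_bounded (i ++ h); set N := M.+1 in bnd.
pose shift a := if a \in h then a else (N + a)%N.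
exists i, h, (map_tuple shift (map_tuple s (ind q).2)); split=> //.
  rewrite -[RHS]kq' -[RHS](@ker_map _ _ shift).
    congr ker; apply: eq_from_tnth => b; rewrite tnth_map /shift mem_tnth //.
  move=> a b _ _; rewrite /shift; case: ifP => ah; case: ifP => bh //.
  - by move=> E; have := bnd a; rewrite mem_cat ah orbT E => /(_ isT); rewrite ltnNge leq_addr.
  - by move=> E; have := bnd b; rewrite mem_cat bh orbT -E => /(_ isT); rewrite ltnNge leq_addr.
  - by move/addnI.
move=> a ai /mapP[b _]; rewrite /shift; case: ifP => [bh -> //|_ E].
by have := bnd a; rewrite mem_cat ai E => /(_ isT); rewrite ltnNge leq_addr.
Qed.

(** * The calculus of words in a skew category *)

(** Membership of kernels in D for words of unspecified length, which avoids
casts between tuple types of provably equal sizes. *)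
Definition word_in (D : forall k l, {set part k l}) (s t : seq nat) : bool :=
  ker (in_tuple s) (in_tuple t) \in D (size s) (size t).

Lemma word_inE (D : forall k l, {set part k l}) k l (i : k.-tuple nat)
    (j : l.-tuple nat) : (ker i j \in D k l) = word_in D i j.
Proof.
case: i j => s es [t et]; rewrite /word_in /=.
have e1 := eqP es; have e2 := eqP et; subst k l.
by rewrite (eq_irrelevance es (eqxx _)) (eq_irrelevance et (eqxx _)).
Qed.

Section SkewWords.
Variable D : forall k l, {set part k l}.
Hypothesis skD : skew_category D.
Implicit Types s t u v w : seq nat.

Lemma word_in_sym s t : word_in D s t -> word_in D t s.
Proof. by rewrite /word_in => /(skew_involution skD); rewrite involution_ker. Qed.

Lemma word_in_cat s t u v :
  word_in D s t -> word_in D u v -> word_in D (s ++ u) (t ++ v).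
Proof.
move=> st uv.
have := @word_inE D _ _ (cat_tuple (in_tuple s) (in_tuple u))
  (cat_tuple (in_tuple t) (in_tuple v)).
move=> /= <-; apply: (skew_tensor skD st uv).
by do 4!eexists; split; [apply/orbit_indP; reflexivity.. |].
Qed.

Lemma word_in_id s : word_in D s s.
Proof.
elim: s => [|a s IH]; last first.
  rewrite -cat1s; apply: word_in_cat => //; rewrite /word_in.
  suff -> : ker (in_tuple [:: a]) (in_tuple [:: a]) = idpart by exact: skew_id skD.
  by apply/ker_eqP => -[x|x] [y|y]; rewrite /= !ord1 !(tnth_nth 0%N) /= !eqxx.
(* The empty pair: create the pair 00 and then remove it. *)
have c := skew_cup skD; have := skew_involution skD c.
rewrite /cup involution_ker => c'.
have := skew_composition skD c' c (compatible_ker _ _ _).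
by rewrite composition_ker // word_inE.
Qed.

Lemma word_in_cup a : word_in D [:: a; a] [::].
Proof.
rewrite /word_in.
suff -> : ker (in_tuple [:: a; a]) (in_tuple [::]) = cup by exact: skew_cup skD.
apply/ker_eqP => -[x|[//]] [y|[//]] /=; rewrite !(tnth_nth 0%N).
by case: x y => [[|[|//]] ?] [[|[|//]] ?]; rewrite /= !eqxx.
Qed.

Lemma word_in_comp_cond s t u : (forall a, a \in s -> a \in u -> a \in t) ->
  word_in D s t -> word_in D t u -> word_in D s u.
Proof.
move=> stu st tu.
have := skew_composition skD st tu (compatible_ker _ _ _).
by rewrite composition_ker.
Qed.

(** Remove the last letter a by bending: s goes to saa by creating the pair aa,
then sa goes to ta beside an identity strand a, and finally taa goes to t.
Both intermediate compositions satisfy the side condition because the word s,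
respectively t, is itself part of the middle word. *)
Lemma word_in_cancel s t w : word_in D (s ++ w) (t ++ w) -> word_in D s t.
Proof.
elim/last_ind: w => [|w a IH]; first by rewrite !cats0.
rewrite -!rcons_cat => H; apply: IH.
move: (s ++ w) (t ++ w) H => {}s {}t H.
have pad x : word_in D (x ++ [:: a; a]) x.
  by rewrite -{2}[x]cats0; apply/word_in_cat/word_in_cup/word_in_id.
apply: (@word_in_comp_cond _ (s ++ [:: a; a])).
- by move=> b bs _; rewrite mem_cat bs.
- exact/word_in_sym/pad.
apply: (@word_in_comp_cond _ (t ++ [:: a; a])); last exact: pad.
  by move=> b _ bt; rewrite mem_cat bt.
rewrite -[[:: a; a]]/([:: a] ++ [:: a]) !catA.
by apply: word_in_cat (word_in_id _); rewrite !cats1.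
Qed.

(** Composition without the condition on shared letters: it becomes automatic
once s is appended to all three words. *)
Lemma word_in_comp s t u : word_in D s t -> word_in D t u -> word_in D s u.
Proof.
move=> st tu; apply: (@word_in_cancel _ _ s).
apply: (@word_in_comp_cond _ (t ++ s)); first by move=> a; rewrite !mem_cat orbb => -> _; rewrite orbT.
  exact: word_in_cat st (word_in_id s).
exact: word_in_cat tu (word_in_id s).
Qed.

End SkewWords.

(** * Matrix entries and the span of the operators *)

Section Coefficients.
Variables (R : realType) (n : nat).
Local Notation C := (R[i]).
Local Notation hom k l := 'Hom(tens R n k, tens R n l).

Definition coef k l (S : hom k l) (i : k.-tuple 'I_n) (j : l.-tuple 'I_n) : C :=
  S (basis R i) j.

Definition ker_of k l (i : k.-tuple 'I_n) (j : l.-tuple 'I_n) : part k l :=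
  ker (up_label i) (up_label j).

Lemma hom_ext k l (S T : hom k l) : coef S =2 coef T -> S = T.
Proof.
move=> ST; apply/lfunP => u; apply/ffunP => j; rewrite !lfun_coord.
by apply: eq_bigr => i _; congr (_ * _); apply: ST.
Qed.

Lemma coef_lin_ext k l (f : k.-tuple 'I_n -> tens R n l) i j :
  coef (lin_ext f) i j = f i j.
Proof. by rewrite /coef lin_extE. Qed.

Lemma sum_basis l (a : l.-tuple 'I_n -> C) j :
  (\sum_j' a j' *: basis R j' : tens R n l) j = a j.
Proof.
rewrite sum_ffunE (bigD1 j) //= big1 => [|j' /negbTE jj'].
  by rewrite addr0 !ffunE eqxx /GRing.scale /= mulr1.
by rewrite !ffunE eq_sym jj' scaler0.
Qed.

Lemma coef_T_hat k l (p : part k l) i j :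
  coef (T_hat R n p) i j = (ker_of i j == p)%:R.
Proof.
rewrite coef_lin_ext sum_basis /delta_hat.
case: asboolP => [/orbit_indP E|nE]; first by rewrite /ker_of E eqxx.
by case: eqP => // /orbit_indP.
Qed.

Lemma coef_htensor k l k' l' (S : hom k l) (T : hom k' l') i j i' j' :
  coef (htensor S T) (cat_tuple i i') (cat_tuple j j') = coef S i j * coef T i' j'.
Proof.
by rewrite coef_lin_ext ffunE !left_part_cat !right_part_cat.
Qed.

Lemma coef_comp k m l (S : hom k m) (T : hom m l) i j :
  coef (T \o S)%VF i j = \sum_h coef S i h * coef T h j.
Proof. by rewrite /coef lfunE /= lfun_coord. Qed.

Lemma coef_adjoint k l (S : hom k l) i j :
  coef (adjoint S) j i = (coef S i j)^*%R.
Proof. by rewrite coef_lin_ext sum_basis. Qed.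

Lemma coef_id i j : coef (\1%VF : hom 1 1) i j = (j == i)%:R.
Proof. by rewrite /coef id_lfunE ffunE. Qed.

Lemma coef_zeta i j :
  coef (zeta R n) i j = (tnth j ord0 == tnth j (lift ord0 ord0))%:R.
Proof.
rewrite coef_lin_ext sum_ffunE.
have jE a : (j == [tuple a; a]) = (tnth j ord0 == a) && (tnth j (lift ord0 ord0) == a).
  apply/eqP/andP => [-> //|[/eqP j0 /eqP j1]].
  apply: eq_from_tnth => x; case: (unliftP ord0 x) => [y|] ->.
    by rewrite ord1 j1.
  by rewrite j0.
rewrite (bigD1 (tnth j ord0)) //= big1 => [|a]; last first.
  by rewrite ffunE jE eq_sym => /negbTE ->.
by rewrite addr0 ffunE jE eqxx /= eq_sym.
Qed.

Section Span.
Variable D : forall k l, {set part k l}.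

Lemma T_hat_span k l (p : part k l) : p \in D k l -> T_hat R n p \in span_T R n D k l.
Proof.
by move=> pD; apply: memv_span; apply/(map_f (@T_hat R n k l)); rewrite mem_enum.
Qed.

(** The operators T_p are the 0-1 indicators of the level sets of the kernel, so
the coefficient of T_p in S is the entry of S at any pair of kernel p. *)
Lemma mem_span_T k l (S : hom k l) :
  S \in span_T R n D k l <->
  (forall i j i' j', ker_of i j = ker_of i' j' -> coef S i j = coef S i' j') /\
  (forall i j, coef S i j != 0 -> ker_of i j \in D k l).
Proof.
split=> [|[Sker SD]].
  set X := [seq T_hat R n p | p in D k l]; move=> /(@coord_span _ _ _ (in_tuple X)) SE.
  have XT a : exists2 p, p \in D k l & (in_tuple X)`_(a : 'I_(size X)) = T_hat R n p.
    have /mapP[p] : (in_tuple X)`_a \in X by rewrite mem_nth.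
    by rewrite mem_enum; exists p.
  have coefS i j : coef S i j =
      \sum_(a < size X) coord (in_tuple X) a S * coef (in_tuple X)`_a i j.
    rewrite {1}SE /coef sum_lfunE sum_ffunE; apply: eq_bigr => a _.
    by rewrite scale_lfunE ffunE.
  split=> [i j i' j' E|i j].
    rewrite !coefS; apply: eq_bigr => a _.
    by have [p _ ->] := XT a; rewrite !coef_T_hat E.
  apply: contraR => nD; rewrite coefS big1 // => a _.
  have [p pD ->] := XT a; rewrite coef_T_hat; case: eqP => [E|]; last by rewrite mulr0.
  by rewrite E pD in nD.
(* A partition with more than n blocks is the kernel of no pair; T_p is then
   0 and its coefficient is immaterial. *)
pose c (p : part k l) : C :=
  if [pick ij | ker_of ij.1 ij.2 == p] is Some ij then coef S ij.1 ij.2 else 0.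
have cE i j : c (ker_of i j) = coef S i j.
  rewrite /c; case: pickP => [ij /eqP /Sker //|/(_ (i, j))]; by rewrite eqxx.
have -> : S = \sum_(p in D k l) c p *: T_hat R n p.
  apply: hom_ext => i j; rewrite {2}/coef sum_lfunE sum_ffunE.
  have E p : (c p *: T_hat R n p) (basis R i) j = c p * (ker_of i j == p)%:R.
    by rewrite -coef_T_hat scale_lfunE ffunE.
  under eq_bigr do rewrite E.
  have [kD|nD] := boolP (ker_of i j \in D k l).
    rewrite (bigD1 (ker_of i j)) //= eqxx mulr1 cE big1 ?addr0 // => p /andP[_].
    by rewrite eq_sym => /negbTE ->; rewrite mulr0.
  rewrite big1 => [|p pD]; first by apply/eqP; apply: contraR nD => /SD.
  by case: eqP pD nD => [-> -> //|_ _ _]; rewrite mulr0.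
by apply: memv_suml => p pD; apply/memvZ/T_hat_span.
Qed.

End Span.
End Coefficients.

(** * Relabelling indices in a finite range *)

Section Relabelling.
Variable n : nat.

Lemma up_label_cat k k' (i : k.-tuple 'I_n) (f : k'.-tuple 'I_n) :
  up_label (cat_tuple i f) = cat_tuple (up_label i) (up_label f).
Proof. by apply: val_inj; rewrite /= map_cat. Qed.

Lemma ker_of_cat_inj k l k' l' (i i' : k.-tuple 'I_n) (j j' : l.-tuple 'I_n)
    (f f' : k'.-tuple 'I_n) (g g' : l'.-tuple 'I_n) :
  ker_of (cat_tuple i f) (cat_tuple j g) =
    ker_of (cat_tuple i' f') (cat_tuple j' g') ->
  ker_of i j = ker_of i' j' /\ ker_of f g = ker_of f' g'.
Proof.
rewrite /ker_of !up_label_cat => /ker_eqP E; split; apply/ker_eqP => x y.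
  pose sh x : 'I_(k + k') + 'I_(l + l') :=
    match x with inl a => inl (lshift k' a) | inr b => inr (lshift l' b) end.
  by have := E (sh x) (sh y); case: x y => [a|a] [b|b] /=; rewrite !tnth_lshift.
pose sh x : 'I_(k + k') + 'I_(l + l') :=
  match x with inl a => inl (rshift k a) | inr b => inr (rshift l b) end.
by have := E (sh x) (sh y); case: x y => [a|a] [b|b] /=; rewrite !tnth_rshift.
Qed.

Lemma ker_of_permute (s : {perm 'I_n}) k l (i : k.-tuple 'I_n) (j : l.-tuple 'I_n) :
  ker_of (map_tuple s i) (map_tuple s j) = ker_of i j.
Proof.
by apply/ker_eqP => -[a|a] [b|b]; rewrite /= !tnth_map !(inj_eq val_inj) (inj_eq perm_inj).
Qed.

Lemma ker_of_eq_permute k l (i i' : k.-tuple 'I_n) (j j' : l.-tuple 'I_n) :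
  ker_of i j = ker_of i' j' ->
  exists s : {perm 'I_n}, i = map_tuple s i' /\ j = map_tuple s j'.
Proof.
move/ker_eqP => E.
pose lab (i : k.-tuple 'I_n) (j : l.-tuple 'I_n) x :=
  match x with inl a => tnth i a | inr b => tnth j b end.
have labE i0 j0 x : label (up_label i0) (up_label j0) x = val (lab i0 j0 x).
  by case: x => a; rewrite /= tnth_map.
have [x y|s sE] := @perm_of_same_kernel _ _ (lab i j) (lab i' j').
  by have := E x y; rewrite !labE.
by exists s; split; apply: eq_from_tnth => a; rewrite tnth_map;
  [exact: (sE (inl a)) | exact: (sE (inr a))].
Qed.

End Relabelling.

Lemma up_label_inord N k (i : k.-tuple nat) : (forall a, a \in i -> (a < N.+1)%N) ->
  exists i' : k.-tuple 'I_N.+1, up_label i' = i.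
Proof.
move=> iN; exists (map_tuple inord i); apply: eq_from_tnth => a.
by rewrite !tnth_map; apply/inordK/iN/mem_tnth.
Qed.

(** * The two implications *)

Section Correspondence.
Variables (R : realType) (D : forall k l, {set part k l}).

(** The multiplicative structure of the spans, entry by entry; closure under
products is where unconditional composition of words is needed. *)
Lemma skew_tensor_category n : skew_category D ->
  tensor_category_with_duals (fun k l => span_T R n D k l).
Proof.
move=> skD; split.
- move=> k l k' l' S T /mem_span_T[Sker SD] /mem_span_T[Tker TD].
  have coefE i j : coef (htensor S T) i j =
      coef S (left_part i) (left_part j) * coef T (right_part i) (right_part j).
    by rewrite -coef_htensor !cat_left_right.
  apply/mem_span_T; split=> i j.
    move=> i' j'; rewrite -{1}(cat_left_right i) -{1}(cat_left_right j).
    rewrite -{1}(cat_left_right i') -{1}(cat_left_right j') !coefE.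
    by case/ker_of_cat_inj => /Sker -> /Tker ->.
  rewrite coefE mulf_eq0 negb_or => /andP[/SD Sij /TD Tij].
  apply: (skew_tensor skD Sij Tij).
  do 4!eexists; split; [apply/orbit_indP; reflexivity..|].
  by rewrite -!up_label_cat !cat_left_right.
- move=> k m l S T /mem_span_T[Sker SD] /mem_span_T[Tker TD].
  apply/mem_span_T; split=> i j.
    move=> i' j' /ker_of_eq_permute[s [-> ->]]; rewrite !coef_comp.
    rewrite (reindex (map_tuple s)) /=.
      by apply: eq_bigr => h _; congr (_ * _); [apply: Sker | apply: Tker];
        rewrite ker_of_permute.
    pose t : {perm 'I_n} := (s^-1)%g; exists (map_tuple t) => h _; apply: eq_from_tnth => a;
      by rewrite !tnth_map ?permK ?permKV.
  apply: contraR => nD; rewrite coef_comp big1 // => h _.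
  apply/eqP; rewrite mulf_eq0; apply: contraR nD; rewrite negb_or.
  case/andP=> /SD + /TD; rewrite /ker_of !word_inE; exact: word_in_comp.
- move=> k l S /mem_span_T[Sker SD]; apply/mem_span_T; split=> j i.
    move=> j' i'; rewrite !coef_adjoint => /(congr1 (@involution _ _)).
    by rewrite !involution_ker => /Sker ->.
  rewrite coef_adjoint conjC_eq0 => /SD /(skew_involution skD).
  by rewrite involution_ker.
- have idE (i j : 1.-tuple 'I_n) : (j == i) =
      (label (up_label i) (up_label j) (inl ord0) ==
       label (up_label i) (up_label j) (inr ord0)).
    rewrite /= !tnth_map (inj_eq val_inj) eq_sym; apply/eqP/eqP => [-> //|ij].
    by apply: eq_from_tnth => a; rewrite ord1.
  apply/mem_span_T; split=> i j.
    by move=> i' j' /ker_eqP E; rewrite !coef_id !idE E.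
  rewrite coef_id; case: (j =P i) => [-> _|]; last by rewrite eqxx.
  by rewrite /ker_of word_inE; apply: word_in_id.
apply/mem_span_T; split=> i j.
  move=> i' j' /ker_eqP E; rewrite !coef_zeta.
  have := E (inr ord0) (inr (lift ord0 ord0)).
  by rewrite /= !tnth_map !(inj_eq val_inj) => ->.
rewrite coef_zeta; case: (tnth j ord0 =P _) => [j01 _|]; last by rewrite eqxx.
have -> : j = [tuple tnth j ord0; tnth j ord0].
  apply: eq_from_tnth => x; case: (unliftP ord0 x) => [y|] -> //.
  by rewrite ord1 -j01.
by rewrite /ker_of word_inE (tuple0 i); apply/word_in_sym/word_in_cup.
Qed.

Hypothesis tcD : forall n, (0 < n)%N ->
  tensor_category_with_duals (fun k l => span_T R n D k l).

(** For n large enough for the chosen labels, each operation on partitions in D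
shows up as a nonzero entry of the matching operation on the T_p. *)
Lemma tensor_category_skew : skew_category D.
Proof.
have invD k l (p : part k l) : p \in D k l -> involution p \in D l k.
  move=> pD; have [kp _] := indP p.
  move: (ind p).1 (ind p).2 kp => i j kp.
  have [N bnd] := labels_bounded (i ++ j).
  have [|i' iE] := @up_label_inord N _ i; first by move=> a ai; rewrite bnd ?mem_cat ?ai.
  have [|j' jE] := @up_label_inord N _ j.
    by move=> a ai; rewrite bnd ?mem_cat ?ai ?orbT.
  have /mem_span_T[_ /(_ j' i')] :=
    tc_adjoint (tcD (ltn0Sn N)) (T_hat_span R N.+1 pD).
  rewrite coef_adjoint conjC_eq0 coef_T_hat /ker_of iE jE -kp eqxx oner_eq0.
  by rewrite involution_ker; apply.
split=> //.
- have /mem_span_T[_ /(_ [tuple] [tuple ord0; ord0])] := tc_zeta (tcD (ltn0Sn 0)).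
  rewrite coef_zeta /= oner_eq0 => /(_ isT) /invD.
  by rewrite involution_ker /cup !word_inE.
- have /mem_span_T[_ /(_ [tuple ord0] [tuple ord0])] := tc_id (tcD (ltn0Sn 0)).
  by rewrite coef_id eqxx oner_eq0 /ker_of /idpart !word_inE; apply.
- move=> k l k' l' p q r pD qD [i [j [f [g []]]]].
  move=> /orbit_indP kp /orbit_indP kq ->.
  have [N bnd] := labels_bounded (i ++ j ++ f ++ g).
  have [|i' iE] := @up_label_inord N _ i.
    by move=> a ai; rewrite bnd // !mem_cat ai ?orbT.
  have [|j' jE] := @up_label_inord N _ j.
    by move=> a ai; rewrite bnd // !mem_cat ai ?orbT.
  have [|f' fE] := @up_label_inord N _ f.
    by move=> a ai; rewrite bnd // !mem_cat ai ?orbT.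
  have [|g' gE] := @up_label_inord N _ g.
    by move=> a ai; rewrite bnd // !mem_cat ai ?orbT.
  have /mem_span_T[_ /(_ (cat_tuple i' f') (cat_tuple j' g'))] :=
    tc_tensor (tcD (ltn0Sn N)) (T_hat_span R N.+1 pD) (T_hat_span R N.+1 qD).
  rewrite coef_htensor !coef_T_hat /ker_of !up_label_cat iE jE fE gE kp kq.
  by rewrite !eqxx mulr1 oner_eq0; apply.
move=> k m l p q pD qD /compatible_labels[i [h [j [kp kq ihj]]]].
rewrite -kp -kq composition_ker //.
have [N bnd] := labels_bounded (i ++ h ++ j).
have [|i' iE] := @up_label_inord N _ i.
  by move=> a ai; rewrite bnd // !mem_cat ai ?orbT.
have [|h' hE] := @up_label_inord N _ h.
  by move=> a ai; rewrite bnd // !mem_cat ai ?orbT.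
have [|j' jE] := @up_label_inord N _ j.
  by move=> a ai; rewrite bnd // !mem_cat ai ?orbT.
have /mem_span_T[_ /(_ i' j')] :=
  tc_comp (tcD (ltn0Sn N)) (T_hat_span R N.+1 pD) (T_hat_span R N.+1 qD).
rewrite /ker_of iE jE; apply; rewrite coef_comp.
under eq_bigr do rewrite !coef_T_hat -natrM.
(* The entry counts the middle words, among them h'. *)
rewrite -natr_sum pnatr_eq0 (bigD1 h') //= /ker_of iE hE jE kp kq.
by rewrite !eqxx.
Qed.

End Correspondence.

Theorem theorem3p5 (R : realType) (D : forall k l : nat, {set part k l}) :
  skew_category D <->
  (forall n : nat, (0 < n)%N ->
     tensor_category_with_duals (fun k l : nat => span_T R n D k l)).
Proof.
split=> [skD n _|]; [exact: skew_tensor_category | exact: tensor_category_skew].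
Qed.
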